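(* There is a function $g:\mathbb{Z}_{\ge 1}\to\mathbb{R}_{\ge 0}$ with $g(t)/t\to 0$ as $t\to\infty$ such that the following hold. (1) For all positive integers $t$ and $n$, every graph on $n$ vertices with no $K_t$-minor has at most $3^{2t/3+g(t)}\,n$ cliques. (2) (Tightness) For all sufficiently large $t$ and every integer $n\ge 4t/3$, there is a graph on $n$ vertices with no $K_t$-minor that has at least $3^{2t/3-g(t)}\,n$ cliques.
   Context: All graphs are finite and simple. A clique of a graph is a set of pairwise adjacent vertices; the empty set and single vertices count as cliques (so the complete graph on $n$ vertices has $2^n$ cliques). A graph $H$ is a minor of a graph $G$ if $H$ can be obtained (up to isomorphism) from $G$ by contracting edges and deleting vertices and edges. The function $g$ makes explicit the error term $o(t)$, which depends only on $t$ (not on $n$ or the graph). *)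

(* Defs.v *)
From HB Require Import structures.
From mathcomp Require Import all_boot.

Set Implicit Arguments.
Unset Strict Implicit.
Unset Printing Implicit Defensive.

Record sgraph := SGraph {
  vertex :> finType;
  adj : rel vertex;
  adj_sym : symmetric adj;
  adj_irr : irreflexive adj
}.

Definition isomorphic (H G : sgraph) : Prop :=
  exists2 f : H -> G, bijective f & forall x y, adj (f x) (f y) = adj x y.

Section Complete.
Variable t : nat.

Definition complete_adj : rel 'I_t := fun x y => x != y.

Lemma complete_sym : symmetric complete_adj.
Proof. by move=> x y; rewrite /complete_adj eq_sym. Qed.

Lemma complete_irr : irreflexive complete_adj.
Proof. by move=> x; rewrite /complete_adj eqxx. Qed.

Definition complete : sgraph := SGraph complete_sym complete_irr.

End Complete.

Section Operations.
Variable G : sgraph.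

Definition del_vertex_adj (v : G) : rel {z : G | z != v} :=
  fun a b => adj (val a) (val b).

Lemma del_vertex_sym v : symmetric (@del_vertex_adj v).
Proof. by move=> a b; rewrite /del_vertex_adj adj_sym. Qed.

Lemma del_vertex_irr v : irreflexive (@del_vertex_adj v).
Proof. by move=> a; rewrite /del_vertex_adj adj_irr. Qed.

Definition del_vertex (v : G) : sgraph :=
  SGraph (@del_vertex_sym v) (@del_vertex_irr v).

Definition del_edge_adj (x y : G) : rel G :=
  fun a b => adj a b && ([set a; b] != [set x; y]).

Lemma del_edge_sym x y : symmetric (del_edge_adj x y).
Proof. by move=> a b; rewrite /del_edge_adj adj_sym setUC. Qed.

Lemma del_edge_irr x y : irreflexive (del_edge_adj x y).
Proof. by move=> a; rewrite /del_edge_adj adj_irr. Qed.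

Definition del_edge (x y : G) : sgraph :=
  SGraph (del_edge_sym x y) (del_edge_irr x y).

(* In the contraction of the edge xy, the vertex y disappears and x plays the
   role of the merged vertex; the test a != b discards the resulting loop. *)
Definition contract_adj (x y : G) : rel {z : G | z != y} :=
  fun a b =>
    (a != b) &&
    [|| adj (val a) (val b),
        (val a == x) && adj y (val b) |
        (val b == x) && adj y (val a)].

Lemma contract_sym x y : symmetric (@contract_adj x y).
Proof.
by move=> a b; rewrite /contract_adj eq_sym adj_sym; congr (_ && (_ || _)); rewrite orbC.
Qed.

Lemma contract_irr x y : irreflexive (@contract_adj x y).
Proof. by move=> a; rewrite /contract_adj eqxx. Qed.

Definition contract (x y : G) : sgraph :=
  SGraph (@contract_sym x y) (@contract_irr x y).

Definition is_clique (A : {set G}) : bool :=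
  [forall x in A, forall y in A, (x != y) ==> adj x y].

Definition num_cliques : nat := #|[set A : {set G} | is_clique A]|.

End Operations.

(* minor H G: H is a minor of G. *)
Inductive minor (H : sgraph) : sgraph -> Prop :=
| minor_iso (G : sgraph) : isomorphic H G -> minor H G
| minor_del_vertex (G : sgraph) (v : G) :
    minor H (del_vertex v) -> minor H G
| minor_del_edge (G : sgraph) (x y : G) :
    adj x y -> minor H (del_edge x y) -> minor H G
| minor_contract (G : sgraph) (x y : G) :
    adj x y -> minor H (contract x y) -> minor H G.

(* Main.v *)
Require Import Defs.
From HB Require Import structures.
From mathcomp Require Import all_boot all_order all_algebra.
From mathcomp Require Import zify lra ring.

(** Let [r] be the cube root of 3, so that 3^(2t/3) = r^(2t).

    Dense graphs.  A graph of order m and clique number k has at most r^(m+k)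
    cliques [card_cliques_in_le].  If in addition every vertex has few
    non-neighbours, then the vertices outside a maximum clique can almost all be
    paired into edges that dominate the graph.  The clique and the pairs form a
    clique minor of order nearly k + (m-k)/2 = (m+k)/2 [few_non_nbrs_card].  So a
    dense graph without K_t minor satisfies m + k <= 2t + o(t) and has at most
    r^(2t + o(t)) cliques.

    Reduction to dense graphs.  A nonempty graph without K_t minor has a vertex
    of degree O(t^2) [minor_of_many_arcs].  Removing such vertices one after the
    other and charging each clique to its first removed vertex gives the factor
    n, and leaves the cliques inside a set of O(t^2) vertices to be counted.
    There, a clique that contains a vertex v lies in the neighbourhood of v
    apart from v, so picking vertices with many non-neighbours quickly shrinks
    the set, and a clique is determined by its few picked vertices and by a
    clique of the dense set where picking stops [cliques_in_picks].  As long as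
    the set has at least of order t log t vertices, some vertex misses a quarter
    of it: otherwise it would contain t disjoint dominating stars with O(log t)
    vertices each, hence a K_t minor [dense_minor].  So O(log t) picks reach size
    O(t log t).  From there on, each pick discards d vertices, where d is larger
    than (log t)^2 but d^2 is still o(t); this takes o(t / log t) picks, at
    O(log t) bits each.  Altogether the picks cost a factor 2^(o(t))
    [num_cliques_le].

    Tightness.  Take disjoint complements of perfect matchings on 2s vertices,
    s being the integer part of (2t-1)/3.  Each contains 3^s cliques.  The
    largest value of clique number plus order over the components does not
    increase under taking minors [class_bounded_minor]; it is at most 3s < 2t
    here, and 2t for the complete graph on t vertices. *)

Set Implicit Arguments.
Unset Strict Implicit.
Unset Printing Implicit Defensive.

(** * Cliques inside a set of vertices *)

Lemma card_bigcup_le (T : finType) (D : {set T}) (F : T -> {set T}) d :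
  {in D, forall w, #|F w| <= d} -> #|\bigcup_(w in D) F w| <= #|D| * d.
Proof.
move=> Fd; apply: (@leq_trans (\sum_(w in D) #|F w|)).
  elim/big_rec2: _ => [|w m U _ leU]; first by rewrite cards0.
  by apply: leq_trans (leq_card_setU _ _).1 _; rewrite leq_add2l.
by rewrite -sum_nat_const; apply: leq_sum.
Qed.

Section Cliques.
Variable G : sgraph.
Implicit Types (S A K : {set G}) (v x y : G).

Lemma is_cliqueP A :
  reflect {in A &, forall x y, x != y -> adj x y} (is_clique A).
Proof.
apply: (iffP forall_inP) => [cA x y xA yA | cA x xA].
  by move/forall_inP: (cA x xA) => /(_ y yA) /implyP.
by apply/forall_inP=> y yA; apply/implyP; apply: cA.
Qed.

Lemma clique_sub A K : A \subset K -> is_clique K -> is_clique A.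
Proof.
move=> sAK /is_cliqueP cK; apply/is_cliqueP => x y xA yA.
by apply: cK; apply: (subsetP sAK).
Qed.

Definition nbrs v : {set G} := [set y | adj v y].

(** A vertex of [S] is its own non-neighbour here, which is what makes
    domination statements uniform. *)
Definition non_nbrs S v : {set G} := S :\: nbrs v.

Lemma clique_add v A :
  is_clique A -> A \subset nbrs v -> is_clique (v |: A).
Proof.
move=> /is_cliqueP cA /subsetP sA; apply/is_cliqueP => x y.
move=> /setU1P[->|xA] /setU1P[->|yA]; first by rewrite eqxx.
- by move/sA: yA; rewrite inE.
- by move/sA: xA; rewrite inE adj_sym.
- exact: cA.
Qed.

Definition cliques_in S : {set {set G}} :=
  [set A | is_clique A & A \subset S].

Lemma card_cliques_in0 : #|cliques_in set0| = 1.
Proof.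
rewrite (_ : cliques_in set0 = [set set0]) ?cards1 //; apply/setP => A.
rewrite !inE subset0 andb_idl // => /eqP->.
by apply/is_cliqueP => x y; rewrite inE.
Qed.

(** A clique inside [S] either avoids [v], or is [v] together with a clique
    among its neighbours: the branching step of every clique count below. *)
Lemma card_cliques_in_split S v : v \in S ->
  #|cliques_in S| = #|cliques_in (S :\ v)| + #|cliques_in (S :&: nbrs v)|.
Proof.
move=> vS; rewrite -(cardsID [set A : {set G} | v \notin A] (cliques_in S)); congr (_ + _).
  apply: eq_card => A; rewrite !inE subsetD1.
  by case: is_clique (A \subset S) (v \in A) => [] [] [].
rewrite -(@card_in_imset _ _ (fun A => v |: A) (cliques_in (S :&: nbrs v))); last first.
  move=> A B; rewrite !inE !subsetI => /and3P[_ _ /subsetP sA] /and3P[_ _ /subsetP sB] eAB.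
  have vN (C : {set G}) : {subset C <= nbrs v} -> v \notin C.
    by move=> sC; apply/negP => /sC; rewrite inE adj_irr.
  by rewrite -(setU1K (vN A sA)) eAB setU1K ?vN.
apply: eq_card => A; apply/idP/imsetP.
  rewrite !inE negbK => /and3P[vA cA sA]; exists (A :\ v); last by rewrite setD1K.
  rewrite inE (clique_sub (subD1set _ _) cA) /=; apply/subsetP => y.
  rewrite !inE => /andP[yv yA]; rewrite (subsetP sA) //=.
  by move/is_cliqueP: cA; apply; rewrite // eq_sym.
move=> [B]; rewrite inE subsetI => /and3P[cB sB nB] ->.
by rewrite !inE eqxx /= clique_add //= subUset sub1set vS.
Qed.

Lemma card_nbrs_non S v : #|S :&: nbrs v| + #|non_nbrs S v| = #|S|.
Proof. by rewrite /non_nbrs cardsID. Qed.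

Lemma self_non_nbrs S v : v \in S -> v \in non_nbrs S v.
Proof. by move=> vS; rewrite !inE adj_irr. Qed.

End Cliques.

(** * Counting cliques by order and clique number *)

Section OrderAndCliqueNumber.
Import Order.TTheory GRing.Theory Num.Theory.
Local Open Scope ring_scope.
Variables (R : realFieldType) (r : R) (G : sgraph).
Hypothesis (r_gt0 : 0 < r) (r3 : r ^+ 3 = 3).

Lemma cbrt3_ge43 : 4 / 3 <= r.
Proof.
rewrite -(@ler_pXn2r _ 3) ?nnegrE ?(ltW r_gt0) ?divr_ge0 // r3.
by lra.
Qed.

Lemma cbrt3_ge1 : 1 <= r.
Proof. by apply: le_trans cbrt3_ge43; lra. Qed.

Lemma cbrt3_sq_ge2 : 2 <= r ^+ 2.
Proof.
rewrite -(@ler_pXn2r _ 3) ?nnegrE ?exprn_ge0 ?(ltW r_gt0) //.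
by rewrite exprAC r3 -!natrX ler_nat.
Qed.

(** With [r] the cube root of 3, a graph of order [m] and clique number [k] has
    at most [r ^+ (m + k)] cliques.  Equality holds for the complement of a
    perfect matching, where deleting a non-adjacent pair divides the count by 3
    and lowers [m + k] by 3.  The other branchings are strictly better: a
    vertex adjacent to everything gives a factor 2 <= r^2, and a vertex with
    two other non-neighbours works because r^(w-1) + r^(w-4) <= r^w. *)
Lemma card_cliques_in_le (S : {set G}) w :
  (forall K, is_clique K -> K \subset S -> #|K| + #|S| <= w)%N ->
  #|cliques_in S|%:R <= r ^+ w.
Proof.
have r1 := cbrt3_ge1; have r2 := cbrt3_sq_ge2.
have r4 : r ^+ 3 + 1 <= r ^+ 4.
  by rewrite [leRHS]exprS r3; have := cbrt3_ge43; lra.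
have [N] := ubnP #|S|; elim: N => // N IH in S w *; rewrite ltnS => leN Hw.
have sub (T : {set G}) w' v : v \in S -> T \subset S :\ v ->
    (forall K, is_clique K -> K \subset T -> #|K| + #|T| <= w')%N ->
    #|cliques_in T|%:R <= r ^+ w'.
  move=> vS sT; apply: IH; apply: leq_trans leN; move/subset_leq_card: sT.
  by rewrite (cardsD1 v S) vS.
have subNv v : v \in S -> S :&: nbrs v \subset S :\ v.
  move=> vS; apply/subsetP => y; rewrite !inE => /andP[-> vy].
  by rewrite andbT; apply: contraTneq vy => ->; rewrite adj_irr.
(* cliques in the neighbourhood of v are one short of a clique in S *)
have Nle v (T K : {set G}) m : v \in S -> T \subset S :&: nbrs v -> (#|T| + m <= #|S|)%N ->
    is_clique K -> K \subset T -> (#|K| + #|T| <= w - m.+1)%N /\ (m < w)%N.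
  move=> vS sT Tm cK sK; have sKN := subset_trans sK sT.
  have [sKS sKv] : K \subset S /\ K \subset nbrs v by move: sKN; rewrite subsetI => /andP.
  have vK : v \notin K by apply/negP => /(subsetP sKv); rewrite inE adj_irr.
  have := Hw _ (clique_add cK sKv); rewrite subUset sub1set vS sKS => /(_ isT).
  rewrite cardsU1 vK; move: Tm; lia.
have clique0 : is_clique (set0 : {set G}) by apply/is_cliqueP => x y; rewrite inE.
have Hge2 v : v \in S -> (2 < #|non_nbrs S v|)%N -> #|cliques_in S|%:R <= r ^+ w.
  move=> vS v2; have := card_nbrs_non S v => cS.
  have Tm : (#|S :&: nbrs v| + 3 <= #|S|)%N by lia.
  have [_ w3] := Nle v _ set0 3 vS (subxx _) Tm clique0 (sub0set _).
  rewrite (card_cliques_in_split vS) natrD.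
  apply: (@le_trans _ _ (r ^+ w.-1 + r ^+ (w - 4))).
    apply: lerD.
      apply: (sub _ _ v vS (subxx _)) => K cK sK.
      have := Hw K cK (subset_trans sK (subD1set _ _)).
      by rewrite (cardsD1 v S) vS; lia.
    apply: (sub _ _ v vS (subNv v vS)) => K cK sK.
    by have [] := Nle v _ K 3 vS (subxx _) Tm cK sK.
  rewrite (_ : w.-1 = (w - 4) + 3)%N; last by lia.
  rewrite -{3}(subnK w3) !exprD -{2}[r ^+ (w - 4)]mulr1 -mulrDr.
  by rewrite ler_wpM2l // exprn_ge0 // ltW.
have [->|[v vS]] := set_0Vmem S.
  by rewrite card_cliques_in0 exprn_ege1.
have [v2|v2] := ltnP 2 #|non_nbrs S v|; first exact: Hge2 v2.
have vv := self_non_nbrs vS.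
have [v1|v1] := ltnP 1 #|non_nbrs S v|; last first.
  (* v is adjacent to all of S, so it may be added to or left out of any clique *)
  have nv : non_nbrs S v = [set v].
    by apply/esym/eqP; rewrite eqEcard sub1set vv cards1.
  have eS : S :&: nbrs v = S :\ v by rewrite -nv /non_nbrs setDDr setDv set0U.
  have Tm : (#|S :&: nbrs v| + 1 <= #|S|)%N.
    by rewrite -(card_nbrs_non S v) nv cards1.
  have [_ w3] := Nle v _ set0 1%N vS (subxx _) Tm clique0 (sub0set _).
  have Hc : #|cliques_in (S :\ v)|%:R <= r ^+ (w - 2).
    rewrite -eS; apply: (sub _ _ v vS (subNv v vS)) => K cK sK.
    by have [] := Nle v _ K 1%N vS (subxx _) Tm cK sK.
  rewrite (card_cliques_in_split vS) eS addnn -mul2n natrM -(subnK w3) exprD mulrC.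
  by apply: ler_pM.
have [y ny yv] : exists2 y, y \in non_nbrs S v & y != v.
  move: v1; rewrite (cardsD1 v) vv ltnS lt0n cards_eq0 => /set0Pn[y].
  by rewrite in_setD1 => /andP[yv yN]; exists y.
have yS : y \in S by move: ny; rewrite inE => /andP[].
have vy : ~~ adj v y by move: ny; rewrite !inE => /andP[].
have [y2|y2] := ltnP 2 #|non_nbrs S y|; first exact: Hge2 y2.
have pair a b : a \in S -> b \in S -> b != a -> ~~ adj a b ->
    (#|non_nbrs S a| <= 2)%N -> non_nbrs S a = [set a; b].
  move=> aS bS ba nab a2; apply/esym/eqP; rewrite eqEcard cards2 eq_sym ba a2 andbT.
  by rewrite subUset !sub1set !inE aS bS adj_irr nab.
(* v and y are each other's only non-neighbour: a clique inside S is a clique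
   inside T, extended by v, by y, or by neither *)
have nv := pair v y vS yS yv vy v2.
have nyy : non_nbrs S y = [set y; v] by apply: pair; rewrite // 1?eq_sym // adj_sym.
have eS a b : non_nbrs S a = [set a; b] -> S :&: nbrs a = S :\: [set a; b].
  by move=> <-; rewrite /non_nbrs setDDr setDv set0U.
set T := S :\: [set v; y].
have eT1 : S :&: nbrs v = T by rewrite (eS _ _ nv).
have eT2 : (S :\ v) :&: nbrs y = T.
  by rewrite setIDAC (eS _ _ nyy) setDDl /T; apply/setP => z; rewrite !inE; case: (z == v); case: (z == y).
have eT3 : (S :\ v) :\ y = T by rewrite setDDl.
have Tm : (#|T| + 2 <= #|S|)%N.
  by rewrite -eT1 -(card_nbrs_non S v) nv cards2 eq_sym yv.
have sT : T \subset S :&: nbrs v by rewrite eT1.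
have [_ w3] := Nle v _ set0 2 vS sT Tm clique0 (sub0set _).
have Hc : #|cliques_in T|%:R <= r ^+ (w - 3).
  apply: (sub _ _ v vS (subset_trans sT (subNv v vS))) => K cK sK.
  by have [] := Nle v _ K 2 vS sT Tm cK sK.
rewrite (card_cliques_in_split vS) (@card_cliques_in_split _ (S :\ v) y); last first.
  by rewrite !inE yv.
rewrite eT1 eT2 eT3 addnn -mul2n addnC -mulSn natrM -(subnK w3) exprD mulrC r3.
by rewrite ler_wpM2r.
Qed.
End OrderAndCliqueNumber.

(** * Clique minors from disjoint stars *)

(** Branch sets of depth one suffice throughout.  Unlike general connected sets,
    they visibly survive the contraction of an edge at the centre. *)
Definition star (G : sgraph) (B : {set G}) :=
  [exists c in B, forall v in B, (v != c) ==> adj c v].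

Definition touch (G : sgraph) (A B : {set G}) :=
  [exists a in A, exists b in B, adj a b].

Lemma card_del_vertex (G : sgraph) (v : G) : #|{: {z : G | z != v}}|.+1 = #|G|.
Proof.
rewrite card_sig (eq_card (B := predC1 v)) // cardC1 prednK //.
by apply/card_gt0P; exists v.
Qed.

(** The branch set of [i] is the fibre of [f] over [Some i], with centre [u i].
    A vertex that is not a centre is removed: by deletion if it has no label,
    by contraction into its centre otherwise.  Once only centres remain, the
    graph is complete. *)
Lemma minor_of_centred_labelling t (G : sgraph) (u : 'I_t -> G) (f : G -> option 'I_t) :
    (forall i, f (u i) = Some i) ->
    (forall v i, f v = Some i -> v != u i -> adj (u i) v) ->
    (forall i j, i != j -> exists a b, [/\ f a = Some i, f b = Some j & adj a b]) ->
  minor (complete t) G.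
Proof.
have [N] := ubnP #|G|; elim: N => // N IH in G u f *; rewrite ltnS => leN fu fstar ftouch.
have u_inj i j : u i = u j -> i = j.
  by move=> /(congr1 f); rewrite !fu => -[].
have card_sub (v : G) : #|{: {z : G | z != v}}| < N.
  by rewrite card_del_vertex.
have [/forallP centre|/forallPn[v nv]] := boolP [forall v, [exists i, v == u i]]; last first.
  have uv i : u i != v.
    by apply: contra nv => /eqP<-; apply/existsP; exists i.
  pose u' i : {z : G | z != v} := exist _ (u i) (uv i).
  case fv: (f v) => [k|].
    have kv : adj (u k) v by apply: fstar; rewrite // eq_sym.
    apply: (minor_contract kv); apply: (IH (contract (u k) v) u' (fun z => f (val z))).
    - exact: card_sub.
    - by move=> i; apply: fu.
    - move=> w i fw wu; rewrite /= /contract_adj eq_sym wu /=.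
      by rewrite fstar.
    - move=> i j ij; have [a [b [fa fb ab]]] := ftouch i j ij.
      have lab (c : G) l : f c = Some l -> f (if c == v then u k else c) = Some l.
        by case: eqP => // ->; rewrite fv fu.
      have neq (c : G) : (if c == v then u k else c) != v by case: ifPn => // _; apply: uv.
      pose m (c : G) : {z : G | z != v} := exist (fun z => z != v) _ (neq c).
      exists (m a), (m b).
      split; [exact: lab | exact: lab | rewrite /= /contract_adj].
      have -> /= : m a != m b.
        rewrite -val_eqE /=; apply/negP => /eqP /(congr1 f); rewrite (lab a i) // (lab b j) //.
        by move=> [] /eqP; apply/negP.
      case: (altP (a =P v)) ab => [->|av]; case: (altP (b =P v)) => [->|bv] ab.
      - by rewrite adj_irr in ab.
      - by rewrite eqxx ab orbT.
      - by rewrite eqxx (adj_sym v a) ab !orbT.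
      - by rewrite ab.
  apply: (@minor_del_vertex _ _ v); apply: (IH (del_vertex v) u' (fun z => f (val z))).
  - exact: card_sub.
  - by move=> i; apply: fu.
  - by move=> w i fw wu; apply: fstar.
  - move=> i j ij; have [a [b [fa fb ab]]] := ftouch i j ij.
    have av : a != v by apply: contraTneq isT => e; rewrite e fv in fa.
    have bv : b != v by apply: contraTneq isT => e; rewrite e fv in fb.
    by exists (exist _ a av), (exist _ b bv).
have fK v i : f v = Some i -> v = u i.
  by move/existsP: (centre v) => [j /eqP->]; rewrite fu => -[->].
apply: minor_iso; exists u.
  have cu v : exists i, v == u i by apply/existsP.
  by exists (fun v => xchoose (cu v)) => [i|v]; [apply: u_inj|]; rewrite -(eqP (xchooseP (cu _))).
move=> i j; rewrite /= /complete_adj; have [<-|ij] := eqVneq i j; first exact: adj_irr.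
by have [a [b [/fK-> /fK-> ->]]] := ftouch i j ij.
Qed.

Lemma minor_of_star_family t (G : sgraph) (B : 'I_t -> {set G}) :
    (forall i, star (B i)) ->
    (forall i j, i != j -> [disjoint B i & B j]) ->
    (forall i j, i != j -> touch (B i) (B j)) ->
  minor (complete t) G.
Proof.
move=> stB disB toB.
pose u i := xchoose (existsP (stB i)).
have uP i : (u i \in B i) && [forall v in B i, (v != u i) ==> adj (u i) v].
  exact: xchooseP (existsP (stB i)).
pose f v := [pick i | v \in B i].
have fB v i : v \in B i -> f v = Some i.
  rewrite /f; case: pickP => [j vj vi|/(_ i) -> //].
  by have [->//|/disB dij] := eqVneq j i; rewrite (disjointFr dij vj) in vi.
have Bf v i : f v = Some i -> v \in B i.
  by rewrite /f; case: pickP => // j vj [<-].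
apply: (@minor_of_centred_labelling t G u f).
- by move=> i; apply: fB; case/andP: (uP i).
- move=> v i /Bf vi vu; have /andP[_ /forall_inP/(_ v vi)] := uP i.
  by rewrite vu.
- move=> i j /toB /existsP[a /andP[ai /existsP[b /andP[bj ab]]]].
  by exists a, b; split; [apply: fB | apply: fB |].
Qed.

Lemma minor_of_stars t (G : sgraph) (P : {set {set G}}) :
    t <= #|P| -> trivIset P -> {in P, forall B, star B} ->
    {in P &, forall A B, A != B -> touch A B} ->
  minor (complete t) G.
Proof.
move=> tP /trivIsetP triv stP toP.
pose B (i : 'I_t) : {set G} := enum_val (widen_ord tP i).
have BP i : B i \in P by apply: enum_valP.
have B_neq i j : i != j -> B i != B j.
  by apply: contraNneq => /enum_val_inj /(congr1 val) /= /val_inj ->.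
apply: (@minor_of_star_family t G B) => [i|i j /B_neq ij|i j /B_neq ij].
- exact: stP.
- exact: triv.
- exact: toP.
Qed.

(** * Clique minors in dense graphs *)

Section Packing.
Variable G : sgraph.
Implicit Types (S K X A B : {set G}).

Definition dominates B S :=
  [forall x in S :\: B, [exists b in B, adj b x]].

Lemma dominating_touch S A B : A \subset S -> [disjoint A & B] ->
  A != set0 -> dominates B S -> touch A B /\ touch B A.
Proof.
move=> sA dAB /set0Pn[a aA] /forall_inP dom.
have /dom /existsP[b /andP[bB ba]] : a \in S :\: B.
  by rewrite inE (subsetP sA) // andbT (disjointFr dAB aA).
split; apply/existsP; [exists a | exists b]; rewrite ?aA ?bB; apply/existsP.
  by exists b; rewrite bB adj_sym.
by exists a; rewrite aA.
Qed.

Lemma star_neq0 B : star B -> B != set0.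
Proof. by move=> /existsP[c /andP[cB _]]; apply/set0Pn; exists c. Qed.

(** Disjoint dominating sets touch each other and every vertex outside them, so
    the singletons of a clique [K] and [q] disjoint dominating stars outside [K]
    form a clique minor of order [#|K| + q].  The stars are found one at a time;
    [X] stands for the vertices that are already taken. *)
Lemma minor_of_dominating_stars t S K m q : t <= #|K| + q ->
    is_clique K -> K \subset S ->
    (forall X, K \subset X -> X \subset S -> #|X| + m <= #|K| + q * m ->
      exists B, [/\ star B, B \subset S :\: X, dominates B S & #|B| <= m]) ->
  minor (complete t) G.
Proof.
move=> tq /is_cliqueP cK sKS ext.
have [P [Pq Ptriv Pok _]] : exists P : {set {set G}},
    [/\ #|P| = q, trivIset P,
        {in P, forall B, [/\ star B, B \subset S :\: K & dominates B S]} &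
        #|cover P| <= q * m].
  elim: {1 3 4}q (leqnn q) => [|i IH] iq.
    exists set0; split; rewrite ?cards0 // /trivIset ?/cover ?big_set0 ?cards0 //.
    by move=> B; rewrite inE.
  have [P [Pi Ptriv Pok Pm]] := IH (ltnW iq).
  have PS : cover P \subset S.
    apply/bigcupsP => B /Pok[_ sB _]; exact: subset_trans sB (subsetDl _ _).
  have [||| B [stB sB domB Bm]] := ext (K :|: cover P).
  - exact: subsetUl.
  - by rewrite subUset sKS.
  - have := (leq_card_setU K (cover P)).1; have : i.+1 * m <= q * m by rewrite leq_mul2r iq orbT.
    by move: Pm; rewrite mulSn; lia.
  move: sB; rewrite subsetD => /andP[sBS]; rewrite disjoints_subset setCU subsetI.
  rewrite -!disjoints_subset => /andP[dBK dBP].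
  have dB C : C \in P -> [disjoint B & C].
    move=> CP; apply: disjointWr dBP; exact: bigcup_sup.
  have BnP : B \notin P.
    apply/negP => /dB; rewrite -setI_eq0 setIid; apply/negP; exact: star_neq0.
  exists (B |: P); split.
  - by rewrite cardsU1 BnP Pi.
  - apply/trivIsetP => C D /setU1P[->|CP] /setU1P[->|DP]; rewrite ?eqxx // => CD.
    + exact: dB.
    + by rewrite disjoint_sym dB.
    + by move/trivIsetP: Ptriv; apply.
  - by move=> C /setU1P[->|/Pok //]; rewrite subsetD sBS dBK.
  - rewrite /cover bigcup_setU big_set1 mulSn.
    apply: leq_trans (leq_card_setU _ _).1 _; exact: leq_add.
pose Q := P :|: [set [set x] | x in K].
have PK B x : B \in P -> x \in K -> [disjoint B & [set x]].
  move=> /Pok[_ + _] xK; rewrite subsetD => /andP[_].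
  by apply: disjointWr; rewrite sub1set.
have star1 (x : G) : star [set x].
  apply/existsP; exists x; rewrite set11; apply/forall_inP => v /set1P->.
  by rewrite eqxx.
apply: (@minor_of_stars _ _ Q).
- apply: leq_trans tq _; rewrite /Q cardsU Pq (card_imset _ (@set1_inj G)) addnC.
  rewrite (_ : P :&: _ = set0) ?cards0 ?subn0 //.
  apply/setP => B; rewrite !inE; apply/negP => /andP[BP /imsetP[x xK eB]].
  by have := PK B x BP xK; rewrite -eB -setI_eq0 setIid eB; apply/negP/set0Pn; exists x; rewrite set11.
- apply/trivIsetP => A B /setUP[AP|/imsetP[x xK ->]] /setUP[BP|/imsetP[y yK ->]] AB.
  + by move/trivIsetP: Ptriv; apply.
  + exact: PK.
  + by rewrite disjoint_sym PK.
  + by rewrite disjoints1 inE; apply: contraNneq AB => ->.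
- by move=> B /setUP[/Pok[]//|/imsetP[x xK ->]].
move=> A B /setUP[AP|/imsetP[x xK ->]] /setUP[BP|/imsetP[y yK ->]] AB.
- have [stA sA _] := Pok A AP; have [_ _ dB] := Pok B BP.
  have dAB : [disjoint A & B] by move/trivIsetP: Ptriv; apply.
  by have [] := dominating_touch (subset_trans sA (subsetDl _ _)) dAB (star_neq0 stA) dB.
- have [_ _ dA] := Pok A AP; have dAy := PK A y AP yK.
  rewrite disjoint_sym in dAy; have sy : [set y] \subset S by rewrite sub1set (subsetP sKS).
  by have [] := dominating_touch sy dAy (star_neq0 (star1 y)) dA.
- have [_ _ dB] := Pok B BP; have dBx := PK B x BP xK.
  rewrite disjoint_sym in dBx; have sx : [set x] \subset S by rewrite sub1set (subsetP sKS).
  by have [] := dominating_touch sx dBx (star_neq0 (star1 x)) dB.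
- apply/existsP; exists x; rewrite set11; apply/existsP; exists y; rewrite set11 /=.
  by apply: cK => //; apply: contraNneq AB => ->.
Qed.

(** If non-neighbourhoods have at most [d] elements, then every vertex [a] forms a
    dominating edge with all but [d * d] vertices [b]: it is enough that no
    non-neighbour of [a] is a non-neighbour of [b].  Hence nearly all vertices
    outside a clique [K] can be paired into dominating edges, and there is a
    clique minor of order about [#|K| + (#|S| - #|K|) / 2]. *)
Lemma few_non_nbrs_card S K d t :
    {in S, forall v, #|non_nbrs S v| <= d} -> is_clique K -> K \subset S ->
  ~ minor (complete t) G -> #|K| + #|S| <= 2 * t + d * d.
Proof.
move=> dS cK sK; apply: contra_notT; rewrite -ltnNge => big.
apply: (@minor_of_dominating_stars t S K 2 (t - #|K|)) => // [|X sKX sXS Xm].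
  by lia.
have KX := subset_leq_card sKX.
have cX : #|S :\: X| + #|X| = #|S| by rewrite cardsD (setIidPr sXS) subnK ?subset_leq_card.
have [a] : exists a, a \in S :\: X by apply/set0Pn; rewrite -card_gt0; lia.
rewrite inE => /andP[aX aS].
pose bad := \bigcup_(w in non_nbrs S a) non_nbrs S w.
have badd : #|bad| <= d * d.
  apply: (@leq_trans (#|non_nbrs S a| * d)); last by rewrite leq_mul2r dS ?orbT.
  by apply: card_bigcup_le => w; rewrite inE => /andP[_ /dS].
have [b] : exists b, b \in (S :\: X) :\: bad.
  apply/set0Pn; rewrite -card_gt0 cardsD subn_gt0.
  by have := subset_leq_card (subsetIr (S :\: X) bad); lia.
rewrite !in_setD => /and3P[nbad bX bS].
have ok w : w \in S -> ~~ adj a w -> adj w b.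
  move=> wS naw; apply: contraR nbad => nwb; apply/bigcupP; exists w; rewrite !inE ?wS ?bS ?andbT //.
(* b is its own non-neighbour, so avoiding the bad set also makes it adjacent to a *)
have ab : adj a b by apply/negPn/negP => /(ok b bS); rewrite adj_irr.
exists [set a; b]; split.
- apply/existsP; exists a; rewrite set21; apply/forall_inP => v /set2P[->|->]; rewrite ?eqxx //.
  by rewrite ab implybT.
- by rewrite subUset !sub1set !inE aX aS bX bS.
- apply/forall_inP => x; rewrite inE => /andP[_ xS]; apply/existsP.
  have [ax|nax] := boolP (adj a x); first by exists a; rewrite set21.
  by exists b; rewrite set22 adj_sym ok.
- by rewrite cards2; case: (_ != _).
Qed.

(** By double counting: on average over [a] in [W], at most half of [Y] is not
    adjacent to [a]. *)
Lemma exists_halving (W Y : {set G}) S : W != set0 -> Y \subset S ->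
    {in S, forall y, 2 * #|non_nbrs W y| <= #|W|} ->
  exists2 a, a \in W & 2 * #|non_nbrs Y a| <= #|Y|.
Proof.
move=> W0 sY half; apply/exists_inP; apply: contraT => /exists_inPn large.
have double : \sum_(a in W) #|non_nbrs Y a| = \sum_(y in Y) #|non_nbrs W y|.
  transitivity (\sum_(a in W) \sum_(y in Y) (~~ adj a y : nat)).
    apply: eq_bigr => a _; rewrite -sum1_card big_mkcond [RHS]big_mkcond /=.
    by apply: eq_bigr => y _; rewrite !inE andbC; case: (y \in Y); case: adj.
  rewrite exchange_big; apply: eq_bigr => y _; rewrite -sum1_card big_mkcond [RHS]big_mkcond /=.
  by apply: eq_bigr => a _; rewrite !inE adj_sym andbC; case: (a \in W); case: adj.
have lower : \sum_(a in W) #|Y|.+1 <= \sum_(a in W) 2 * #|non_nbrs Y a|.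
  by apply: leq_sum => a aW; rewrite ltnNge large.
have upper : \sum_(y in Y) 2 * #|non_nbrs W y| <= \sum_(y in Y) #|W|.
  by apply: leq_sum => y yY; apply: half; apply: (subsetP sY).
move: lower upper; rewrite -!big_distrr /= double !sum_nat_const.
by move: W0; rewrite -card_gt0; nia.
Qed.

Lemma exists_small_dominating (W : {set G}) S i : W != set0 ->
    {in S, forall y, 2 * #|non_nbrs W y| <= #|W|} ->
  exists A, [/\ A \subset W, #|A| <= i
    & 2 ^ i * #|[set y in S | [forall a in A, ~~ adj a y]]| <= #|S|].
Proof.
move=> W0 half; elim: i => [|i [A [sA Ai Ysmall]]].
  exists set0; rewrite sub0set cards0 mul1n; split=> //.
  by apply/subset_leq_card/subsetP => y; rewrite inE => /andP[].
set Y := [set y in S | _] in Ysmall.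
have sY : Y \subset S by apply/subsetP => y; rewrite inE => /andP[].
have [a aW Ya] := exists_halving W0 sY half.
exists (a |: A); split.
- by rewrite subUset sub1set aW.
- by rewrite cardsU1; case: (_ \notin _); rewrite ?add1n ?add0n // leqW.
apply: leq_trans Ysmall; rewrite expnSr -mulnA leq_mul2l; apply/orP; right.
apply: leq_trans Ya; rewrite leq_mul2l; apply/orP; right.
apply/subset_leq_card/subsetP => y; rewrite !inE => /andP[-> /forall_inP Ha].
rewrite Ha ?setU11 //=; apply/forall_inP => b bA; apply: Ha.
by rewrite setU1r.
Qed.

(** When every vertex misses at most a quarter of [S], repeated halving finds,
    among the neighbours of any free vertex [a], a set of [s] vertices that
    dominates [S] as soon as [2 ^ s] exceeds [#|S|]; together with [a] it is a
    dominating star.  The [t * s.+1] vertices used by [t] such stars are at most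
    a quarter of [S], so at least half of [S] is free and adjacent to [a]. *)
Lemma dense_minor S s t :
    {in S, forall v, 4 * #|non_nbrs S v| <= #|S|} ->
    4 * (t * s.+1) <= #|S| -> #|S| < 2 ^ s ->
  minor (complete t) G.
Proof.
move=> quarter big small.
have cl0 : is_clique (set0 : {set G}) by apply/is_cliqueP => x y; rewrite inE.
apply: (@minor_of_dominating_stars t S set0 s.+1 t) => [||| X _ sXS]; rewrite ?cards0 ?sub0set // add0n => Xm.
have cX : #|S :\: X| + #|X| = #|S| by rewrite cardsD (setIidPr sXS) subnK ?subset_leq_card.
have [a] : exists a, a \in S :\: X by apply/set0Pn; rewrite -card_gt0; lia.
rewrite inE => /andP[aX aS].
pose W := (S :\: X) :&: nbrs a.
have cW : #|S| <= 2 * #|W|.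
  have := quarter a aS; have := card_nbrs_non (S :\: X) a.
  have : #|non_nbrs (S :\: X) a| <= #|non_nbrs S a|.
    by apply/subset_leq_card/setSD/subsetDl.
  rewrite -/W; lia.
have W0 : W != set0 by rewrite -card_gt0; lia.
have half : {in S, forall y, 2 * #|non_nbrs W y| <= #|W|}.
  move=> y yS; have := quarter y yS.
  have : #|non_nbrs W y| <= #|non_nbrs S y|.
    apply/subset_leq_card/setSD; apply: subset_trans (subsetIl _ _) (subsetDl _ _).
  lia.
have [A [sA As Asmall]] := @exists_small_dominating W S s W0 half.
have dom : [set y in S | [forall a in A, ~~ adj a y]] = set0.
  apply/eqP; rewrite -cards_eq0; apply: contraTT small => /=; rewrite -lt0n -leqNgt => pos.
  by apply: leq_trans Asmall; rewrite leq_pmulr.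
exists (a |: A); split.
- apply/existsP; exists a; rewrite setU11; apply/forall_inP => v /setU1P[->|vA].
    by rewrite eqxx.
  by have := subsetP sA v vA; rewrite !inE => /andP[_ ->]; rewrite implybT.
- rewrite subUset sub1set inE aX aS; apply: subset_trans sA _; exact: subsetIl.
- apply/forall_inP => x; rewrite inE => /andP[_ xS]; apply/existsP.
  have := in_set0 x; rewrite -dom inE xS /= => /negbT /forall_inPn[b bA].
  by rewrite negbK => bx; exists b; rewrite setU1r.
- by rewrite cardsU1; case: (_ \notin _); rewrite ?add1n ?add0n // leqW.
Qed.

End Packing.

(** * Clique minors in graphs with many edges *)

Lemma distinct_representatives (I T : finType) (A : I -> {set T}) :
  (forall i, #|I| <= #|A i|) -> exists2 w : I -> T, injective w & forall i, w i \in A i.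
Proof.
move=> big.
have A0 i : exists x, x \in A i.
  by apply/set0Pn; rewrite -card_gt0; apply: leq_trans (big i); apply/card_gt0P; exists i.
suff [w [w_inj wA]] : exists w : I -> T,
    {in enum I &, injective w} /\ forall i, w i \in A i.
  by exists w => // i j; apply: w_inj; rewrite mem_enum.
elim: (enum I) (enum_uniq I) => [_|i s IH] /=.
  by exists (fun i => xchoose (A0 i)); split=> // i; apply: xchooseP.
case/andP=> ins us; have [w [w_inj wA]] := IH us.
have [x] : exists x, x \in A i :\: [set w j | j in s].
  apply/set0Pn; rewrite -card_gt0 cardsD subn_gt0.
  apply: leq_trans (big i); apply: leq_ltn_trans (subset_leq_card (subsetIr _ _)) _.
  apply: leq_ltn_trans (leq_imset_card _ _) _.
  by rewrite -(cardC (mem s)) -[ltnLHS]addn0 ltn_add2l; apply/card_gt0P; exists i.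
rewrite inE => /andP[xw xA].
exists (fun j => if j == i then x else w j); split; last by move=> j; case: eqP => [->|].
have notx j : j \in s -> w j <> x.
  by move=> js e; case/imsetP: xw; exists j.
move=> j l; rewrite !inE; case: eqVneq => [->|_] /=; case: eqVneq => [->|_] //=.
- by move=> _ ls /esym /notx; case.
- by move=> js _ /notx; case.
- exact: w_inj.
Qed.

Section HalfDense.
Variables (G : sgraph) (W : {set G}) (t : nat).
Let c := t * t + t.
Let codeg x y := #|(W :&: nbrs x) :&: (W :&: nbrs y)|.

(** Each vertex of [W] sees at least half of [W]; this is the neighbourhood of a
    suitable vertex in an edge-minimal graph. *)
Hypothesis W0 : W != set0.
Hypothesis Wsmall : #|W| <= 6 * c.
Hypothesis Wdeg : {in W, forall x, 3 * c <= #|W :&: nbrs x|}.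

(** Three subsets of [W], each at least half its size, cannot be almost disjoint. *)
Lemma large_codeg_triple x y z : x \in W -> y \in W -> z \in W -> 0 < t ->
  [|| c <= codeg x y, c <= codeg x z | c <= codeg y z].
Proof.
move=> xW yW zW t0; rewrite /codeg; move: (Wdeg xW) (Wdeg yW) (Wdeg zW).
set X := W :&: nbrs x; set Y := W :&: nbrs y; set Z := W :&: nbrs z => Xc Yc Zc.
have c0 : 0 < c by rewrite /c; lia.
have : #|(X :|: Y) :|: Z| <= #|W|.
  by apply: subset_leq_card; rewrite !subUset !subsetIl.
have h1 := cardsUI X Y; have h2 := cardsUI (X :|: Y) Z.
have : #|(X :|: Y) :&: Z| <= #|X :&: Z| + #|Y :&: Z|.
  by rewrite setIUl; apply: (leq_card_setU _ _).1.
move: Wsmall; lia.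
Qed.

(** Call two vertices far if they have few common neighbours.  By
    [large_codeg_triple], the vertices far from a given one are pairwise not far.
    So if [C] is a largest set of pairwise not far vertices, then at most [#|C|]
    vertices are far from each element of [C], while by maximality every vertex
    of [W] is in [C] or far from an element of [C]; thus [#|C|] is at least of
    order the square root of [#|W|]. *)
Lemma large_codeg_set : 0 < t ->
  exists2 C : {set G}, C \subset W /\ t <= #|C| &
    {in C &, forall x y, x != y -> c <= codeg x y}.
Proof.
move=> t0.
pose good (C : {set G}) :=
  (C \subset W) && [forall x in C, forall y in C, (x != y) ==> (c <= codeg x y)].
have goodP (C : {set G}) : reflect (C \subset W /\ {in C &, forall x y, x != y -> c <= codeg x y}) (good C).
  apply: (iffP andP) => -[sC Hc]; split=> //.
    move=> x y xC yC; apply/implyP; have /forall_inP := forall_inP Hc x xC; exact.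
  by apply/forall_inP => x xC; apply/forall_inP => y yC; apply/implyP; apply: Hc.
have good0 : good set0 by apply/goodP; split; [apply: sub0set | move=> x y; rewrite inE].
case: (@arg_maxnP _ set0 good (fun C => #|C|) good0) => C /goodP[sC Cc] Cmax.
exists C => //; split=> //; rewrite leqNgt; apply/negP => Ct.
pose far u : {set G} := [set v in W | (v != u) && (codeg u v < c)].
have far_good u : u \in W -> good (far u).
  move=> uW; apply/goodP; split; first by apply/subsetP => v; rewrite inE => /andP[].
  move=> x y; rewrite !inE => /and3P[xW _ ux] /and3P[yW _ uy] xy.
  by have := large_codeg_triple uW xW yW t0; move: ux uy; rewrite !ltnNge => /negbTE-> /negbTE->.
have cover_W : W \subset \bigcup_(u in C) (u |: far u).
  apply/subsetP => v vW; apply/bigcupP.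
  have [vC|vC] := boolP (v \in C); first by exists v; rewrite ?setU11.
  have nCv : ~ good (v |: C).
    by move=> /Cmax /=; rewrite cardsU1 vC add1n ltnn.
  have [/existsP[u /andP[uC uv]]|/existsPn none] := boolP [exists u in C, codeg u v < c].
    exists u; rewrite // !inE vW uv; case: eqVneq => // e; by rewrite e uC in vC.
  case: nCv; apply/goodP; split; first by rewrite subUset sub1set vW.
  have symc x y : codeg x y = codeg y x by rewrite /codeg setIC.
  have nonec u : u \in C -> c <= codeg u v.
    by move=> uC; have := none u; rewrite uC /= -leqNgt.
  move=> x y /setU1P[->|xC] /setU1P[->|yC] xy; rewrite ?eqxx // in xy *.
  - by rewrite symc nonec.
  - exact: nonec.
  - exact: Cc.
have : #|W| <= #|C| * t.
  apply: leq_trans (subset_leq_card cover_W) _.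
  apply: card_bigcup_le => u uC.
  have := Cmax _ (far_good u (subsetP sC _ uC)).
  by rewrite cardsU1; move: Ct; case: (_ \notin _); lia.
have [x xW] := set0Pn _ W0.
have := Wdeg xW; have := subset_leq_card (subsetIl W (nbrs x)).
by rewrite /c; nia.
Qed.

(** Join every two of [t] vertices with many common neighbours through a common
    neighbour of their own: a subdivision of the complete graph. *)
Lemma minor_of_half_dense : 0 < t -> minor (complete t) G.
Proof.
move=> t0; have [C [sC tC] Cc] := large_codeg_set t0.
pose u (i : 'I_t) : G := enum_val (widen_ord tC i).
have uC i : u i \in C by apply: enum_valP.
have u_inj : injective u.
  by move=> i j /enum_val_inj /(congr1 val) /= /val_inj.
pose U := [set u i | i : 'I_t].
pose common (p : 'I_t * 'I_t) := ((W :&: nbrs (u p.1)) :&: (W :&: nbrs (u p.2))) :\: U.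
have commonP p : #|{: 'I_t * 'I_t}| <= #|common p|.
  rewrite card_prod !card_ord /common cardsD.
  have cU : #|U| = t by rewrite card_imset // card_ord.
  have := subset_leq_card (subsetIr ((W :&: nbrs (u p.1)) :&: (W :&: nbrs (u p.2))) U).
  suff : c <= codeg (u p.1) (u p.2) by rewrite /codeg /c cU; lia.
  have [->|ne] := eqVneq p.1 p.2; last by apply: Cc; rewrite // (inj_eq u_inj).
  rewrite /codeg setIid; apply: leq_trans (Wdeg (subsetP sC _ (uC p.2))); lia.
have [w w_inj wP] := distinct_representatives commonP.
have wU p i : w p != u i.
  by apply/negP => /eqP e; have := wP p; rewrite !inE e imset_f.
have wadj p : adj (u p.1) (w p) && adj (u p.2) (w p).
  by have := wP p; rewrite !inE; case/and3P=> _ /andP[_ ->] /andP[_ ->].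
pose B i := u i |: [set w (i, j) | j : 'I_t].
apply: (@minor_of_star_family t G B) => [i|i j ij|i j ij].
- apply/existsP; exists (u i); rewrite setU11; apply/forall_inP => v /setU1P[->|].
    by rewrite eqxx.
  by case/imsetP => j _ ->; apply/implyP => _; case/andP: (wadj (i, j)).
- rewrite -setI_eq0; apply/eqP/setP => v; rewrite in_set0; apply/negP => /setIP[].
  move=> /setU1P[->|/imsetP[k _ ->]] /setU1P[|/imsetP[l _]].
  + by move/u_inj => e; rewrite e eqxx in ij.
  + by move=> e; have := wU (j, l) i; rewrite e eqxx.
  + by move=> e; have := wU (i, k) j; rewrite e eqxx.
  + by move=> /w_inj [e _]; rewrite e eqxx in ij.
- apply/existsP; exists (w (i, j)); rewrite setU1r ?imset_f //; apply/existsP.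
  by exists (u j); rewrite setU11 adj_sym; case/andP: (wadj (i, j)).
Qed.
End HalfDense.

Definition arcs (G : sgraph) : {set G * G} := [set p | adj p.1 p.2].

Lemma card_arcs G : #|arcs G| = \sum_v #|nbrs (v : G)|.
Proof.
rewrite -sum1_card.
rewrite (eq_bigl (fun p : G * G => true && (p.2 \in nbrs p.1))); last first.
  by move=> p; rewrite !inE.
rewrite -(pair_big_dep (fun _ => true) (fun v y => y \in nbrs v) (fun _ _ => 1)).
by apply: eq_bigr => v _; rewrite sum1_card.
Qed.

Lemma card_arcs_del_vertex (G : sgraph) (v : G) :
  #|arcs G| <= #|arcs (del_vertex v)| + 2 * #|nbrs v|.
Proof.
pose f (p : del_vertex v * del_vertex v) : G * G := (val p.1, val p.2).
have sub : arcs G \subset f @: arcs (del_vertex v) :|: (pair v @: nbrs v :|: (fun y => (y, v)) @: nbrs v).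
  apply/subsetP => -[a b]; rewrite inE /= => ab.
  have [av|av] := eqVneq a v.
    by rewrite !inE; apply/orP; right; apply/orP; left; apply/imsetP; exists b; rewrite -?av // inE.
  have [bv|bv] := eqVneq b v.
    rewrite !inE; apply/orP; right; apply/orP; right; apply/imsetP.
    by exists a; rewrite -?bv // inE adj_sym.
  rewrite inE; apply/orP; left; apply/imsetP.
  by exists (exist _ a av, exist _ b bv); rewrite ?inE.
apply: leq_trans (subset_leq_card sub) _.
apply: leq_trans (leq_card_setU _ _).1 _; apply: leq_add; first exact: leq_imset_card.
apply: leq_trans (leq_card_setU _ _).1 _; rewrite mul2n -addnn.
by apply: leq_add; apply: leq_imset_card.
Qed.

Lemma card_arcs_del_edge (G : sgraph) (x y : G) : adj x y ->
  #|arcs (del_edge x y)| < #|arcs G| <= #|arcs (del_edge x y)| + 2.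
Proof.
move=> xy; apply/andP; split.
  apply/proper_card/properP; split.
    by apply/subsetP => -[a b]; rewrite !inE => /andP[].
  by exists (x, y); rewrite !inE //= /del_edge_adj eqxx andbF.
have sub : arcs G \subset (arcs (del_edge x y) : {set G * G}) :|: [set (x, y); (y, x)].
  apply/subsetP => -[a b]; rewrite !inE /= /del_edge_adj => ab; rewrite ab /=.
  case: eqP => //= /setP e.
  have := e a; have := e b; rewrite !inE !eqxx orbT /=.
  move=> /esym/orP[]/eqP eb /esym/orP[]/eqP ea; subst a b; rewrite ?eqxx ?orbT //.
  - by rewrite adj_irr in ab.
  - by rewrite adj_irr in ab.
apply: leq_trans (subset_leq_card sub) _.
apply: leq_trans (leq_card_setU _ _).1 _; rewrite leq_add2l cards2.
by case: (_ != _).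
Qed.

(** Contracting [xy] loses the edge itself and merges the two edges from each
    common neighbour.  The kept arcs inject into the contracted graph; the lost
    ones are those between [y] and [x] or a common neighbour. *)
Lemma card_arcs_contract (G : sgraph) (x y : G) : adj x y ->
  #|arcs G| <= #|arcs (contract x y)| + 2 * (#|nbrs x :&: nbrs y|).+1.
Proof.
move=> xy; have nxy : x != y by apply: contraTneq xy => ->; rewrite adj_irr.
have mP c : (if c == y then x else c) != y by case: ifPn.
pose m c : contract x y := exist (fun z => z != y) _ (mP c).
pose D := x |: (nbrs x :&: nbrs y).
pose lost := pair y @: D :|: (fun b => (b, y)) @: D.
have cD : #|D| <= #|nbrs x :&: nbrs y|.+1.
  by rewrite cardsU1; case: (_ \notin _); rewrite ?add1n ?add0n.
have clost : #|lost| <= 2 * #|nbrs x :&: nbrs y|.+1.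
  apply: leq_trans (leq_card_setU _ _).1 _; rewrite mul2n -addnn.
  by apply: leq_add; apply: leq_trans (leq_imset_card _ _) cD.
rewrite -(cardsID lost (arcs G)) addnC; apply: leq_add; last first.
  by apply: leq_trans clost; apply/subset_leq_card/subsetIr.
have keptP a b : (a, b) \in arcs G :\: lost ->
  [/\ adj a b, a = y -> b != x /\ ~~ adj x b & b = y -> a != x /\ ~~ adj x a].
  rewrite !inE /= negb_or => /andP[/andP[l1 l2] ab]; split=> // e; subst; apply/andP.
  - rewrite -negb_or; apply: contra l1 => bx; apply/imsetP; exists b; rewrite // !inE ab andbT.
    exact: bx.
  - rewrite -negb_or; apply: contra l2 => ax; apply/imsetP; exists a; rewrite // !inE.
    by rewrite (adj_sym y) ab andbT.
pose f (p : G * G) := (m p.1, m p.2).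
rewrite -(@card_in_imset _ _ f) => [|[a b] [a' b'] /keptP[ab ay by_] /keptP[ab' ay' by'] [ea eb]].
  apply/subset_leq_card/subsetP => _ /imsetP[[a b] /keptP[ab ay by_] ->].
  rewrite inE /= /contract_adj -val_eqE /=.
  have nab : a != b by apply: contraTneq ab => ->; rewrite adj_irr.
  have [ey|_] := eqVneq a y.
    have [bx nb] := ay ey; rewrite ey in ab nab.
    by rewrite (eq_sym b y) (negbTE nab) (eq_sym x b) bx eqxx ab orbT.
  have [ey|_] := eqVneq b y.
    have [ax na] := by_ ey; rewrite ey in ab nab.
    by rewrite ax eqxx adj_sym (adj_sym y a) ab !orbT.
  by rewrite nab ab.
have irr (z : G) : adj z z -> False by rewrite adj_irr.
move: ea eb; case: (eqVneq a y) (eqVneq a' y) => [ea|na] [ea'|na'];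
  case: (eqVneq b y) (eqVneq b' y) => [eb|nb] [eb'|nb'] e1 e2; subst => //.
all: try by case: (irr _ ab).
all: try by case: (irr _ ab').
all: try by have [] := ay erefl; rewrite ?eqxx ?ab'.
all: try by have [] := ay' erefl; rewrite ?eqxx ?ab.
all: try by have [_ /negP[]] := by_ erefl; rewrite adj_sym.
all: try by have [_ /negP[]] := by' erefl; rewrite adj_sym.
Qed.

(** Mader's argument.  The density hypothesis passes to minors until deleting any
    edge or contracting any edge would destroy it.  Then the average degree is
    no larger than required, so some vertex [v] has at most [6 * c] neighbours,
    and each of them has at least [3 * c] neighbours in common with [v]:
    the neighbourhood of [v] is half dense. *)
Theorem minor_of_many_arcs t (G : sgraph) : 0 < t -> 0 < #|G| ->
  6 * (t * t + t) * #|G| <= #|arcs G| -> minor (complete t) G.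
Proof.
move=> t0; set c := t * t + t; have c0 : 0 < c by rewrite /c; lia.
have [N] := ubnP #|G|; elim: N => // N IHN in G *; rewrite ltnS => leN.
have [M] := ubnP #|arcs G|; elim: M => // M IHM in G leN *; rewrite ltnS => leM G0 dense.
have [more|less] := leqP (6 * c * #|G| + 2) #|arcs G|.
  have [[x y]] : exists p, p \in arcs G by apply/set0Pn; rewrite -card_gt0; lia.
  rewrite inE /= => xy; have /andP[lt le] := card_arcs_del_edge xy.
  apply: (minor_del_edge xy); apply: IHM => //; first exact: leq_trans leM.
  by rewrite -/c; change #|del_edge x y| with #|G|; lia.
have deg_lt (v : G) : #|nbrs v| < #|G|.
  rewrite -cardsT [ltnRHS](cardsD1 v) inE ltnS; apply/subset_leq_card/subsetP => y.
  by rewrite !inE andbT; apply: contraTneq => ->; rewrite adj_irr.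
have [/existsP[v vsmall]|/existsPn large] := boolP [exists v : G, #|nbrs v| <= 6 * c]; last first.
  have [v _] := card_gt0P G0; have := large v; have := deg_lt v; rewrite -ltnNge => h1 h2.
  have : \sum_(v : G) (6 * c).+1 <= #|arcs G|.
    by rewrite card_arcs; apply: leq_sum => w _; rewrite ltnNge large.
  have -> : \sum_(v : G) (6 * c).+1 = #|G| + 6 * c * #|G|.
    by rewrite sum_nat_const mulnS (mulnC (6 * c)); congr (_ + _ * _); apply: eq_card.
  move: less h1 h2; lia.
have del : #|del_vertex v|.+1 = #|G| := card_del_vertex v.
have G1 : 1 < #|G|.
  rewrite ltnNge; apply/negP => G1; have : \sum_(w : G) #|nbrs w| <= \sum_(w : G) 0.
    by apply: leq_sum => w _; have := deg_lt w; lia.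
  have : 0 < 6 * c * #|G| by rewrite !muln_gt0 c0 G0.
  by rewrite -card_arcs sum_nat_const; lia.
rewrite -del mulnS in dense.
have [v0|vpos] := eqVneq (nbrs v) set0.
  apply: (@minor_del_vertex _ _ v); apply: IHN; try lia.
  by have := card_arcs_del_vertex v; rewrite v0 cards0; lia.
have [/existsP[x /andP[]]|/existsPn codeg] := boolP [exists x in nbrs v, #|nbrs v :&: nbrs x| < 3 * c].
  rewrite inE => vx small; apply: (minor_contract vx).
  have cc : #|contract v x|.+1 = #|G| := card_del_vertex x.
  have cd : #|contract v x| = #|del_vertex v| by apply: succn_inj; rewrite cc.
  apply: IHN; rewrite ?cd; try lia.
  by have := card_arcs_contract vx; lia.
apply: (@minor_of_half_dense G (nbrs v)) => // x xv.
by have := codeg x; rewrite xv /= -leqNgt.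
Qed.

(** * Counting cliques by successive picks *)

Section Upper.
Import Order.TTheory GRing.Theory Num.Theory.
Local Open Scope ring_scope.
Variable (R : realFieldType).

(** [Q j k] says that a set of [k] vertices becomes a leaf after at most [j] picks.
    Removing vertices one at a time, each clique either survives to a leaf or is
    charged to the first removed vertex that it contains, and is then a clique
    of the neighbourhood of that vertex.  So a clique is determined by at most
    [j] picked vertices and a clique of a leaf. *)
Lemma cliques_in_picks (G : sgraph) (leaf : pred {set G}) (Q : nat -> nat -> bool) (b : R) m :
    0 <= b ->
    (forall T : {set G}, leaf T -> #|cliques_in T|%:R <= b) ->
    (forall j k k', (k <= k')%N -> Q j k' -> Q j k) ->
    (forall T : {set G}, Q 0%N #|T| -> leaf T) ->
    (forall j (T : {set G}), ~~ leaf T -> Q j.+1 #|T| -> exists2 v, v \in T & Q j #|T :&: nbrs v|) ->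
  forall j (S : {set G}), (#|S| <= m)%N -> Q j #|S| -> #|cliques_in S|%:R <= b * m.+1%:R ^+ j.
Proof.
move=> b0 leafb Qmono Q0 Qstep; elim=> [|j IHj] S Sm QS.
  by rewrite mulr1; apply/leafb/Q0.
set X := b * m.+1%:R ^+ j in IHj.
have ind (T : {set G}) : (#|T| <= m)%N -> Q j.+1 #|T| -> #|cliques_in T|%:R <= #|T|.+1%:R * X.
  have [N] := ubnP #|T|; elim: N => // N IHN in T *; rewrite ltnS => TN Tm QT.
  have [lT|nlT] := boolP (leaf T).
    apply: le_trans (leafb _ lT) _; rewrite mulrCA ler_peMr //.
    apply: mulr_ege1; first by rewrite ler1n.
    by rewrite exprn_ege1 // ler1n.
  have [v vT Qv] := Qstep j T nlT QT.
  have Tv : #|T :\ v|.+1 = #|T| by rewrite (cardsD1 v T) vT.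
  have hle : (#|T :&: nbrs v| <= #|T|)%N by apply/subset_leq_card/subsetIl.
  rewrite (card_cliques_in_split vT) natrD -addn1 natrD mulrDl mul1r -Tv; apply: lerD.
    by apply: IHN; rewrite ?Tv //; [lia | apply: Qmono QT; lia].
  by apply: IHj Qv; apply: leq_trans Tm.
have X0 : 0 <= X by rewrite mulr_ge0 // exprn_ge0.
apply: le_trans (ind S Sm QS) _.
by rewrite exprSr mulrA mulrC -/X ler_wpM2l // ler_nat.
Qed.

Variable r : R.
Hypotheses (r_gt0 : 0 < r) (r3 : r ^+ 3 = 3).

Section NoMinor.
Variables (G : sgraph) (t : nat).
Hypothesis noK : ~ minor (complete t) G.

(** Each pick of a vertex with more than [d] non-neighbours costs [d] vertices;
    when no such vertex is left, the graph is dense enough for the sharp bound. *)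
Lemma cliques_in_medium d M j (S : {set G}) :
    (#|S| <= M)%N -> (M <= j.+1 * d)%N ->
  #|cliques_in S|%:R <= r ^+ (2 * t + d * d) * M.+1%:R ^+ j.
Proof.
move=> SM Mj.
pose leaf := [pred T : {set G} | [forall v in T, #|non_nbrs T v| <= d]%N].
apply: (@cliques_in_picks G leaf (fun i k => k <= i.+1 * d)%N) => //.
- by rewrite exprn_ge0 ?ltW.
- move=> T /forall_inP few; apply: (card_cliques_in_le r_gt0 r3) => K cK sK.
  exact: (few_non_nbrs_card few cK sK noK).
- by move=> i k k' /leq_trans; apply.
- move=> T Td; apply/forall_inP => v _; apply: leq_trans (_ : #|T| <= _)%N.
    exact/subset_leq_card/subsetDl.
  by rewrite mul1n in Td.
- move=> i T /forall_inPn[v vT many] Ti; exists v => //.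
  by have := card_nbrs_non T v; move: many Ti; rewrite -ltnNge [(i.+2 * d)%N]mulSn; lia.
- exact: leq_trans Mj.
Qed.

(** Above size [M], [dense_minor] provides a vertex that misses a quarter of the
    set, so each pick multiplies the size by at most 3/4. *)
Lemma cliques_in_large d j i s m (S : {set G}) :
    let M := (4 * (t * s.+1))%N in
    (M <= j.+1 * d)%N -> (#|S| <= m)%N -> (m < 2 ^ s)%N -> (3 ^ i * m <= 4 ^ i * M)%N ->
  #|cliques_in S|%:R <= r ^+ (2 * t + d * d) * M.+1%:R ^+ j * m.+1%:R ^+ i.
Proof.
move=> M Mj Sm ms mM.
pose leaf := [pred T : {set G} | #|T| <= M]%N.
apply: (@cliques_in_picks G leaf (fun i k => (3 ^ i * k <= 4 ^ i * M) && (k <= m))%N) => //.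
- by rewrite mulr_ge0 // exprn_ge0 ?ltW.
- by move=> T TM; apply: cliques_in_medium.
- move=> i' k k' kk' /andP[h km]; rewrite (leq_trans kk' km) andbT.
  by apply: leq_trans h; rewrite leq_mul2l kk' orbT.
- by move=> T /andP[]; rewrite !mul1n.
- move=> i' T; rewrite /leaf /= -ltnNge => MT /andP[iT Tm].
  have [/forall_inP quarter|/forall_inPn[v vT many]] :=
    boolP [forall v in T, 4 * #|non_nbrs T v| <= #|T|]%N.
    by case: noK; apply: (dense_minor quarter (ltnW MT)); apply: leq_ltn_trans ms.
  have c := card_nbrs_non T v; exists v => //; apply/andP; split; last by lia.
  rewrite -ltnNge in many; rewrite -(@leq_pmul2l 4) // [leqRHS]mulnA -expnS.
  apply: leq_trans iT; rewrite mulnCA expnSr -mulnA leq_mul2l; apply/orP; right; lia.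
- by rewrite Sm andbT; apply: leq_trans mM; rewrite leq_mul2l Sm orbT.
Qed.
End NoMinor.

Lemma cliques_in_del_vertex (G : sgraph) (v : G) :
  (#|cliques_in [set~ v]| <= num_cliques (del_vertex v))%N.
Proof.
pose f (A : {set G}) : {set del_vertex v} := val @^-1: A.
have fK A : A \in cliques_in [set~ v] -> val @: f A = A.
  rewrite inE => /andP[_ /subsetP sA]; apply/setP => x; apply/imsetP/idP.
    by case=> a; rewrite inE => aA ->.
  move=> xA; have := sA x xA; rewrite !inE => xv.
  by exists (exist _ x xv); rewrite ?inE.
rewrite -(@card_in_imset _ _ f) => [|A B /fK eA /fK eB e]; last by rewrite -eA -eB e.
apply/subset_leq_card/subsetP => _ /imsetP[A + ->]; rewrite !inE => /andP[/is_cliqueP cA _].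
by apply/is_cliqueP => a b; rewrite !inE => aA bA ab; apply: cA.
Qed.

(** Peel off a vertex of small degree: the cliques through it lie in its
    neighbourhood.  The final [1] counts the empty clique. *)
Lemma num_cliques_peel t (b : R) (G : sgraph) : (0 < t)%N ->
    (forall G' : sgraph, ~ minor (complete t) G' ->
       forall S : {set G'}, (#|S| <= 6 * (t * t + t))%N -> #|cliques_in S|%:R <= b) ->
  ~ minor (complete t) G -> (num_cliques G)%:R <= #|G|%:R * b + 1.
Proof.
move=> t0 nbb; have [N] := ubnP #|G|; elim: N => // N IH in G *; rewrite ltnS => GN noK.
have eG : num_cliques G = #|cliques_in [set: G]|.
  by apply: eq_card => A; rewrite !inE subsetT andbT.
have [G0|G0] := posnP #|G|.
  by rewrite eG (cards0_eq (A := setT)) ?cardsT // card_cliques_in0 G0 mul0r add0r.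
have [/existsP[v vlow]|/existsPn high] := boolP [exists v : G, #|nbrs v| <= 6 * (t * t + t)]%N; last first.
  case: noK; apply: minor_of_many_arcs => //; rewrite mulnC -sum_nat_const card_arcs.
  by apply: leq_sum => v _; apply: ltnW; rewrite ltnNge high.
rewrite eG (card_cliques_in_split (in_setT v)) setTI natrD -(card_del_vertex v) -addn1 natrD mulrDl mul1r.
rewrite addrAC; apply: lerD; last exact: nbb.
rewrite setTD; apply: le_trans (_ : (num_cliques (del_vertex v))%:R <= _).
  by rewrite ler_nat; apply: cliques_in_del_vertex.
apply: IH; first by rewrite -(card_del_vertex v) in GN.
by move=> mK; apply/noK/(minor_del_vertex mK).
Qed.
End Upper.

(** * Disjoint unions of cocktail party graphs *)

(** A bound on clique number plus order, over all connected components.  The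
    labelling [comp] may be coarser than connectedness, which makes it trivial
    to carry along a deletion. *)
Definition class_bounded w (G : sgraph) := exists comp : G -> nat,
  (forall x y, adj x y -> comp x = comp y) /\
  (forall c (K : {set G}), is_clique K -> {in K, forall x, comp x = c} ->
     #|K| + #|[set x | comp x == c]| <= w).

(** Deletions only shrink cliques and classes.  A contraction can enlarge a clique
    by one, the merged vertex, but then the class has lost a vertex. *)
Lemma class_bounded_minor w H G :
  minor H G -> class_bounded w G -> class_bounded w H.
Proof.
elim=> {G} [G [f f_bij f_adj]|G v _ IH|G x y xy _ IH|G x y xy _ IH] [comp [cadj cw]].
- have f_inj := bij_inj f_bij.
  exists (comp \o f); split=> [a b ab|c K /is_cliqueP cK Kc].
    by apply: cadj; rewrite f_adj.
  have fK : is_clique (f @: K).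
    apply/is_cliqueP => _ _ /imsetP[a aK ->] /imsetP[b bK ->].
    by rewrite (inj_eq f_inj) f_adj; apply: cK.
  have fKc : {in f @: K, forall z, comp z = c} by move=> _ /imsetP[a aK ->]; apply: Kc.
  apply: leq_trans (cw c _ fK fKc); rewrite (card_imset _ f_inj) leq_add2l.
  rewrite -(card_imset _ f_inj); apply/subset_leq_card/subsetP => _ /imsetP[a + ->].
  by rewrite !inE.
- apply: IH; exists (comp \o val); split=> [a b ab|c K /is_cliqueP cK Kc].
    exact: cadj.
  have vK : is_clique (val @: K).
    apply/is_cliqueP => _ _ /imsetP[a aK ->] /imsetP[b bK ->].
    by rewrite (inj_eq val_inj); apply: cK.
  have vKc : {in val @: K, forall z, comp z = c} by move=> _ /imsetP[a aK ->]; apply: Kc.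
  apply: leq_trans (cw c _ vK vKc); rewrite (card_imset _ val_inj) leq_add2l.
  rewrite -(card_imset _ val_inj); apply/subset_leq_card/subsetP => _ /imsetP[a + ->].
  by rewrite !inE.
- apply: IH; exists comp; split=> [a b /andP[ab _]|c K /is_cliqueP cK Kc]; first exact: cadj.
  apply: cw => //; apply/is_cliqueP => a b aK bK ab.
  by have /andP[] := cK a b aK bK ab.
have cxy : comp x = comp y := cadj _ _ xy.
apply: IH; exists (comp \o val); split=> [a b /andP[_]|c K /is_cliqueP cK Kc].
  case/or3P => [|/andP[/eqP ax yb]|/andP[/eqP bx ya]] /=.
  - exact: cadj.
  - by rewrite ax cxy; apply: cadj.
  - by rewrite bx cxy; apply/esym/cadj.
pose V : {set G} := val @: [set z : contract x y | comp (val z) == c].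
have cV : #|V| = #|[set z : contract x y | (comp \o val) z == c]|.
  by rewrite (card_imset _ val_inj).
have sV : V \subset [set z | comp z == c].
  by apply/subsetP => _ /imsetP[a + ->]; rewrite !inE.
have vKc : {in val @: K, forall z, comp z = c} by move=> _ /imsetP[a aK ->]; apply: Kc.
have vK (a b : contract x y) : a \in K -> b \in K -> val a != x -> val b != x -> a != b ->
    adj (val a) (val b).
  move=> aK bK ax bx ab; have /andP[_] := cK a b aK bK ab.
  by rewrite (negbTE ax) (negbTE bx) !orbF.
rewrite -cV -(card_imset (mem K) val_inj).
have [xK|xK] := boolP (x \in val @: K); last first.
  apply: leq_trans (cw c (val @: K) _ vKc); first by rewrite leq_add2l subset_leq_card.
  apply/is_cliqueP => _ _ /imsetP[a aK ->] /imsetP[b bK ->]; rewrite (inj_eq val_inj).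
  by apply: vK => //; apply: contraNneq xK => <-; apply: imset_f.
have cc : comp x = c := vKc x xK.
have yV : y \notin V by apply/negP => /imsetP[a _ e]; have := valP a; rewrite /= -e eqxx.
have yVs : y |: V \subset [set z | comp z == c] by rewrite subUset sub1set sV inE -cxy cc eqxx.
have := cw c ((val @: K) :\ x).
have := subset_leq_card yVs; rewrite cardsU1 yV (cardsD1 x (val @: K)) xK.
set k := #|_ :\ x|; move=> le1 le2.
suff : k + #|[set z | comp z == c]| <= w by lia.
apply: le2.
  apply/is_cliqueP => x1 x2 /setD1P[ax /imsetP[a aK ea]] /setD1P[bx /imsetP[b bK eb]].
  rewrite {}ea in ax *; rewrite {}eb in bx *.
  by rewrite (inj_eq val_inj); apply: vK.
by move=> z /setD1P[_ /vKc].
Qed.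

Lemma class_bounded_complete w t : 0 < t -> class_bounded w (complete t) -> 2 * t <= w.
Proof.
case: t => // t _ [comp [cadj cw]].
have all0 (x : 'I_t.+1) : comp x = comp ord0.
  by have [->//|x0] := eqVneq x ord0; apply: cadj.
have := cw (comp ord0) [set: 'I_t.+1].
rewrite (_ : [set x | _] = [set: 'I_t.+1]).
  rewrite cardsT card_ord mul2n addnn; apply=> [|x _]; last exact: all0.
  by apply/is_cliqueP.
by apply/setP => x; rewrite !inE all0 eqxx.
Qed.

Section Cocktail.
Variables (n r : nat).
Let s := r.+1.

(** Consecutive blocks of [2 * s] vertices, the last one possibly incomplete;
    inside a block, all pairs are adjacent but [2i] and [2i + 1]. *)
Definition cocktail_adj : rel 'I_n := fun x y =>
  (x %/ (2 * s) == y %/ (2 * s)) && (x./2 != y./2).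

Lemma cocktail_sym : symmetric cocktail_adj.
Proof. by move=> x y; rewrite /cocktail_adj eq_sym [x./2 == _]eq_sym. Qed.

Lemma cocktail_irr : irreflexive cocktail_adj.
Proof. by move=> x; rewrite /cocktail_adj [x./2 == _]eqxx andbF. Qed.

Definition cocktail := SGraph cocktail_sym cocktail_irr.

Lemma block_half x : x %/ (2 * s) = x./2 %/ s.
Proof. by rewrite divnMA divn2. Qed.

Lemma cocktail_class_bounded : class_bounded (3 * s) cocktail.
Proof.
exists (fun x : 'I_n => x %/ (2 * s)); split=> [x y /andP[/eqP]//|c K /is_cliqueP cK Kc].
have Ks : #|K| <= s.
  pose f (x : 'I_n) := Ordinal (ltn_pmod x./2 (isT : 0 < s)).
  rewrite -(card_ord s) -(@card_in_imset _ _ f) ?max_card // => x y xK yK /(congr1 val) /= e.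
  apply/eqP/negPn/negP => /(cK x y xK yK) /andP[_ /eqP[]].
  rewrite (divn_eq x./2 s) (divn_eq y./2 s) e -!block_half.
  by rewrite (Kc x xK) (Kc y yK).
have classs : #|[set x : 'I_n | x %/ (2 * s) == c]| <= 2 * s.
  pose f (x : 'I_n) := Ordinal (ltn_pmod x (isT : 0 < 2 * s)).
  rewrite -[leqRHS]card_ord -(@card_in_imset _ _ f) ?max_card // => x y.
  rewrite !inE => /eqP cx /eqP cy /(congr1 val) /= e; apply/val_inj.
  by rewrite /= (divn_eq x (2 * s)) (divn_eq y (2 * s)) e cx cy.
by move: Ks classs; rewrite mulSn; apply: leq_add.
Qed.

(** A complete block and the choice of one vertex or none in each of its pairs.  In
    the first pair the even vertex is always chosen, so that the block can be
    read off the clique. *)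
Let pick_clique (p : 'I_(n %/ (2 * s)) * {ffun 'I_r -> option bool}) : {set cocktail} :=
  [set x : 'I_n | (x %/ (2 * s) == p.1) &&
    ((x./2 %% s == 0) && ~~ odd x
     || [exists k : 'I_r, (x./2 %% s == k.+1) && (p.2 k == Some (odd x))])].

Lemma pick_clique_clique p : is_clique (pick_clique p).
Proof.
apply/is_cliqueP => x y; rewrite !inE => /andP[/eqP bx hx] /andP[/eqP by_ hy] xy.
rewrite /adj /= /cocktail_adj bx by_ eqxx /=; apply: contraNneq xy => e.
suff eo : odd x = odd y by apply/eqP/val_inj; rewrite /= -(odd_double_half x) -(odd_double_half y) eo e.
move: hx hy; rewrite e => /orP[/andP[/eqP x0 ox]|/existsP[k /andP[/eqP xk /eqP hk]]].
  rewrite x0 /= => /orP[oy|/existsP[k]//]; by rewrite (negbTE ox) (negbTE oy).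
rewrite xk /= => /existsP[l /andP[/eqP [kl] /eqP hl]].
by move: hk; rewrite (val_inj kl) hl => -[].
Qed.

Lemma block_vertex (j : 'I_(n %/ (2 * s))) i (b : bool) : i < s -> exists x : 'I_n,
  [/\ x %/ (2 * s) = j, x./2 %% s = i & odd x = b].
Proof.
move=> is_; have jn : j * (2 * s) + 2 * s <= n.
  by rewrite addnC -mulSn; apply: leq_trans (leq_trunc_div n (2 * s)); rewrite leq_mul2r ltn_ord orbT.
have lt : j * (2 * s) + (2 * i + b) < n by case: b; lia.
have half : (j * (2 * s) + (2 * i + b))./2 = j * s + i.
  by case: (b); lia.
exists (Ordinal lt); split; rewrite /= ?half.
- by rewrite block_half half divnMDl // (divn_small is_) addn0.
- by rewrite modnMDl modn_small.
- by case: (b); lia.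
Qed.

Lemma num_cliques_cocktail : n %/ (2 * s) * 3 ^ r <= num_cliques cocktail.
Proof.
have pick_inj : injective pick_clique.
  move=> [j h] [j' h'] e.
  have ej : j = j'.
    (* the vertex forced in the first pair determines the block *)
    have [x [xj x0 xo]] := @block_vertex j 0 false isT.
    have : x \in pick_clique (j, h) by rewrite inE /= xj x0 xo !eqxx.
    by rewrite e inE /= xj => /andP[/eqP/val_inj].
  subst j'; congr (_, _); apply/ffunP => k.
  have hb b : (h k == Some b) = (h' k == Some b).
    have [x [xj xk xo]] := @block_vertex j k.+1 b (ltn_ord k : k.+1 < s).
    have mem g : (x \in pick_clique (j, g)) = (g k == Some b).
      rewrite inE /= xj xk xo eqxx /=; apply/existsP/idP => [[l /andP[/eqP[kl] gl]]|gk].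
        by rewrite (val_inj kl).
      by exists k; rewrite eqxx.
    by rewrite -!mem e.
  by move: (hb true) (hb false); case: (h k) (h' k) => [[]|] [[]|].
have card_index : #|{: 'I_(n %/ (2 * s)) * {ffun 'I_r -> option bool}}| = n %/ (2 * s) * 3 ^ r.
  by rewrite card_prod card_ffun !card_ord card_option card_bool.
rewrite -card_index -cardsT -(card_imset _ pick_inj); apply/subset_leq_card/subsetP => _ /imsetP[p _ ->].
by rewrite inE pick_clique_clique.
Qed.
End Cocktail.

(** * Choice of the parameters *)

(** The integer part of the seventh root of [t].  As [t] is less than
    [2 ^ (7 * root7 t)], it stands in for the logarithm of [t] as an upper bound,
    while every fixed power of it that occurs below is still at most
    [t %/ root7 t], the order of the error term. *)
Definition root7 t := \max_(i < t.+1 | i ^ 7 <= t) i.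

Lemma root7_le t : root7 t ^ 7 <= t.
Proof.
rewrite /root7; elim/big_ind: _ => // m n mt nt.
by rewrite /maxn; case: ifP.
Qed.

Lemma leq_expS m k : m <= m ^ k.+1.
Proof. by case: m => // m; rewrite expnS leq_pmulr // expn_gt0. Qed.

Lemma leq_root7 k t : k ^ 7 <= t -> k <= root7 t.
Proof.
move=> kt; have kt1 : k < t.+1 by rewrite ltnS (leq_trans (leq_expS _ _) kt).
exact: (@leq_bigmax_cond _ (fun i : 'I_t.+1 => i ^ 7 <= t) _ (Ordinal kt1)).
Qed.

Lemma root7_gt t : t < 2 ^ (7 * root7 t).
Proof.
rewrite mulnC expnM; apply: (@leq_trans ((root7 t).+1 ^ 7)).
  by rewrite ltnNge; apply/negP => /leq_root7; rewrite ltnn.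
by rewrite leq_exp2r // ltn_expl.
Qed.

(** The bounds of [cliques_in_large] for sets of at most [6 * (t * t + t)]
    vertices, the degree bound from [minor_of_many_arcs].  The parameters are
    [s = 18 * u], so that [2 ^ s] exceeds this size, [d = u ^ 3], so that the loss
    [d * d] in the sharp bound is at most [z], and [54 * u] picks in the large
    range followed by [152 * (z %/ u).+1] in the medium range. *)
Section ParameterChoice.
Variable t : nat.
Hypothesis t_gt0 : 0 < t.
Let u := root7 t.
Let z := t %/ u.

Lemma root7_gt0 : 0 < u. Proof. exact: leq_root7. Qed.

Lemma root7_pow6 : u ^ 6 <= z.
Proof. by rewrite leq_divRL ?root7_gt0 // -expnSr root7_le. Qed.

Lemma root7_pow2 : u ^ 2 <= z.
Proof. by apply: leq_trans root7_pow6; rewrite leq_pexp2l ?root7_gt0. Qed.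

Lemma root7_quotient : u <= z.
Proof. by apply: leq_trans root7_pow2; apply: leq_expS. Qed.

Lemma ltn_quotient : t < 2 * (z * u).
Proof.
have := ltn_ceil t root7_gt0; rewrite -/z mulSn => /leq_trans; apply.
by rewrite mul2n -addnn leq_add2r leq_pmull // (leq_trans root7_gt0 root7_quotient).
Qed.

Lemma degeneracy_lt : 6 * (t * t + t) < 2 ^ (18 * u).
Proof.
apply: (@leq_ltn_trans (12 * (t * t))); first by have := leq_pmulr t t_gt0; lia.
apply: (@leq_trans (2 ^ 4 * (2 ^ (7 * u) * 2 ^ (7 * u)))).
  have lt : t * t < 2 ^ (7 * u) * 2 ^ (7 * u) by apply: ltn_mul; apply: root7_gt.
  by move: lt; set a := t * t; set b := _ * _; lia.
by rewrite -!expnD leq_exp2l //; have := root7_gt0; lia.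
Qed.

Let M := 4 * (t * (18 * u).+1).

Lemma medium_lt : M < 2 ^ (15 * u).
Proof.
have u0 := root7_gt0.
apply: (@leq_trans (2 ^ 7 * (2 ^ (7 * u) * 2 ^ u))); last first.
  by rewrite -!expnD leq_exp2l //; lia.
have : t * u < 2 ^ (7 * u) * 2 ^ u by apply: ltn_mul; [apply: root7_gt | apply: ltn_expl].
have : t <= t * u by apply: leq_pmulr.
by rewrite /M mulnS (mulnCA t 18 u); set a := t * u; set b := _ * _; lia.
Qed.

Lemma medium_picks : M <= (152 * (z %/ u).+1).+1 * u ^ 3.
Proof.
have u0 := root7_gt0; have zu := ltn_ceil z u0; have tz := ltn_quotient.
have : M <= 152 * (z * (u * u)).
  apply: (@leq_trans (76 * (t * u))).
    by have : t <= t * u by [apply: leq_pmulr]; rewrite /M mulnS (mulnCA t 18 u); lia.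
  have : t * u <= 2 * (z * u) * u by rewrite leq_mul2r (ltnW tz) orbT.
  by rewrite -mulnA -mulnA; lia.
have : z * (u * u) <= (z %/ u).+1 * u * (u * u) by rewrite leq_mul2r (ltnW zu) orbT.
rewrite -mulnA (_ : u * (u * u) = u ^ 3); last by rewrite !expnS expn0 muln1.
rewrite [(152 * _).+1 * _]mulSn -[152 * _ * u ^ 3]mulnA.
by move: (_.+1 * u ^ 3) (z * _) => a b; lia.
Qed.

Lemma large_picks : 3 ^ (54 * u) * (6 * (t * t + t)) <= 4 ^ (54 * u) * M.
Proof.
have M0 : 0 < M by rewrite /M !muln_gt0 t_gt0.
apply: (@leq_trans (3 ^ (54 * u) * 2 ^ (18 * u))).
  by rewrite leq_mul2l (ltnW degeneracy_lt) orbT.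
apply: leq_trans (leq_pmulr _ M0).
have -> : 54 * u = 3 * (18 * u) by rewrite mulnA.
rewrite (expnM 3 3) (expnM 4 3) -expnMn leq_exp2r //.
by rewrite muln_gt0 root7_gt0.
Qed.

(** The total number of bits needed to record all picks. *)
Lemma picks_exponent :
  15 * u * (152 * (z %/ u).+1) + 18 * u * (54 * u) <= 3 * (2000 * z).
Proof.
have := leq_trunc_div z u; have := root7_quotient; have := root7_pow2.
rewrite expnS expn1 => h1 h2 h3.
have -> : 15 * u * (152 * (z %/ u).+1) = 2280 * (z %/ u * u + u) by rewrite mulnAC -mulSnr; lia.
have -> : 18 * u * (54 * u) = 972 * (u * u) by rewrite mulnACA.
by move: h1 h2 h3; rewrite -/u -/z; move: (z %/ u * u) (u * u) => a b; lia.
Qed.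

End ParameterChoice.

(** * The two bounds in terms of the cube root of 3 *)

Section Bounds.
Import Order.TTheory GRing.Theory Num.Theory.
Local Open Scope ring_scope.
Variables (R : realFieldType) (r : R).
Hypotheses (r_gt0 : 0 < r) (r3 : r ^+ 3 = 3).

Lemma natr_le_cbrt3 k e : (k <= 2 ^ e)%N -> k%:R <= r ^+ (2 * e).
Proof.
move=> ke; apply: (@le_trans _ _ ((2 ^ e)%:R)); first by rewrite ler_nat.
rewrite natrX exprM lerXn2r ?nnegrE ?exprn_ge0 // ?(ltW r_gt0) //.
exact: cbrt3_sq_ge2.
Qed.

(** The error exponent collects [u ^ 6 <= z] from the sharp bound, twice the
    number of bits in [picks_exponent] since 2 <= r^2, and 2 from bounding
    [n * b + 1] by [2 * (n * b)]. *)
Lemma num_cliques_le t (G : sgraph) : (0 < t)%N -> (0 < #|G|)%N ->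
    ~ minor (complete t) G ->
  (num_cliques G)%:R <= r ^+ (2 * t + 3 * (4500 * (t %/ root7 t))) * #|G|%:R.
Proof.
move=> t0 G0 noK; set u := root7 t; set z := (t %/ u)%N.
have z0 : (0 < z)%N := leq_trans (root7_gt0 t0) (root7_quotient t0).
have r1 := cbrt3_ge1 r_gt0 r3; have r_ge0 := ltW r_gt0.
pose b := r ^+ (2 * t + (z + 2 * (3 * (2000 * z)))).
have bound (G' : sgraph) : ~ minor (complete t) G' ->
    forall S : {set G'}, (#|S| <= 6 * (t * t + t))%N -> #|cliques_in S|%:R <= b.
  move=> noK' S Sm.
  apply: le_trans (cliques_in_large r_gt0 r3 noK' (medium_picks t0) Sm
    (degeneracy_lt t0) (large_picks t0)) _.
  rewrite -/u -/z -mulrA /b; set M := (4 * _)%N; set m := (6 * _)%N; set j := (152 * _)%N.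
  have hM : M.+1%:R ^+ j <= r ^+ (2 * (15 * u * j)).
    by rewrite -natrX natr_le_cbrt3 // [leqRHS]expnM leq_exp2r // medium_lt.
  have hm : m.+1%:R ^+ (54 * u) <= r ^+ (2 * (18 * u * (54 * u))).
    by rewrite -natrX natr_le_cbrt3 // [leqRHS]expnM leq_exp2r ?muln_gt0 ?root7_gt0 // degeneracy_lt.
  apply: le_trans (_ : r ^+ (2 * t + u ^ 3 * u ^ 3) *
      (r ^+ (2 * (15 * u * j)) * r ^+ (2 * (18 * u * (54 * u)))) <= _).
    by rewrite ler_wpM2l ?exprn_ge0 // ler_pM ?exprn_ge0.
  rewrite -!exprD ler_weXn2l //.
  have := picks_exponent t0; have := root7_pow6 t0; rewrite -/u -/z -/j -expnD.
  move: (15 * u * j)%N (18 * u * (54 * u))%N (u ^ 6)%N; lia.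
apply: le_trans (num_cliques_peel t0 bound noK) _.
have b1 : 1 <= b by rewrite exprn_ege1.
have G1 : 1 <= #|G|%:R :> R by rewrite ler1n.
apply: (@le_trans _ _ (r ^+ 2 * b * #|G|%:R)).
  have bG : 1 <= b * #|G|%:R by apply: mulr_ege1.
  rewrite -mulrA; apply: (@le_trans _ _ (2 * (b * #|G|%:R))); first by lra.
  by rewrite ler_wpM2r ?cbrt3_sq_ge2 //; lra.
by rewrite ler_wpM2r // -exprD ler_weXn2l //; lia.
Qed.

(** With [s] the integer part of (2t - 1)/3, a cocktail party graph on [2 * s]
    vertices has clique number plus order equal to [3 * s], below the value
    [2 * t] of the complete graph. *)
Lemma cocktail_bound t n : (1 < t)%N -> (4 * t <= 3 * n)%N ->
  exists G : sgraph, [/\ #|G| = n, ~ minor (complete t) G &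
    r ^+ (2 * t) * n%:R <= r ^+ (3 * (4500 * (t %/ root7 t))) * (num_cliques G)%:R].
Proof.
move=> t1 tn; have t0 : (0 < t)%N by lia.
have r1 := cbrt3_ge1 r_gt0 r3; have r_ge0 := ltW r_gt0.
pose p := ((2 * t - 1) %/ 3 - 1)%N; exists (cocktail n p); split.
- by rewrite card_ord.
- move=> /class_bounded_minor/(_ (cocktail_class_bounded n p)).
  by move=> /(class_bounded_complete t0); rewrite /p; lia.
(* q blocks are complete; counting only them, rounding, and restricting to one
   choice in the first pair lose a factor of at most 4 * t * r ^ 6 *)
set q := (n %/ (2 * p.+1))%N.
have nq : (n <= 4 * t * q)%N.
  have := ltn_ceil n (isT : 0 < 2 * p.+1)%N; rewrite -/q => lt.
  have q0 : (0 < q)%N by rewrite divn_gt0 // /p; lia.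
  apply: leq_trans (ltnW lt) _; apply: (@leq_trans (q.*2 * (2 * p.+1))%N).
    by rewrite leq_mul2r; apply/orP; right; lia.
  rewrite -muln2 -mulnA mulnC leq_mul2r; apply/orP; right; rewrite /p; lia.
apply: (@le_trans _ _ (r ^+ (3 * (4500 * (t %/ root7 t))) * (q * 3 ^ p)%:R)); last first.
  by rewrite ler_wpM2l ?exprn_ge0 // ler_nat num_cliques_cocktail.
apply: (@le_trans _ _ (r ^+ (3 * p + 6) * (4 * t * q)%:R)).
  rewrite ler_pM ?exprn_ge0 // ?ler_nat // ler_weXn2l //; rewrite /p; lia.
have h4t : (4 * t)%:R <= r ^+ (2 * (2 + 7 * root7 t)).
  by apply: natr_le_cbrt3; rewrite expnD leq_mul2l (ltnW (root7_gt t)).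
rewrite exprD exprM r3 !natrM -natrM natrX.
rewrite (_ : 3 ^+ p * r ^+ 6 * ((4 * t)%:R * q%:R) = r ^+ 6 * (4 * t)%:R * (q%:R * 3 ^+ p)); last by ring.
rewrite ler_wpM2r ?mulr_ge0 ?exprn_ge0 //.
apply: le_trans (ler_wpM2l _ h4t) _; first by rewrite exprn_ge0.
rewrite -exprD ler_weXn2l //.
have := root7_quotient t0; have := root7_gt0 t0; lia.
Qed.
End Bounds.

(** * Real exponents and the error term *)

From mathcomp Require Import all_classical all_reals all_analysis.
Import Order.TTheory GRing.Theory Num.Theory.
Import numFieldNormedType.Exports.
Local Open Scope classical_set_scope.
Local Open Scope ring_scope.

Lemma powR_third (R : realType) (k : nat) (x : R) :
  x * 3 = k%:R -> 3 `^ x = (3 `^ 3^-1) ^+ k.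
Proof.
by move=> xk; rewrite -powR_mulrn ?powR_ge0 // -powRrM -xk mulrCA mulVf ?mulr1.
Qed.

Lemma quotient_root7_cvg0 (R : realType) (c : nat) :
  (fun t : nat => (c * (t %/ root7 t))%:R / t%:R : R) @ \oo --> (0 : R).
Proof.
apply/cvgrPdist_le => e e0; near=> t.
pose k := (Num.bound (c%:R / e)).+1.
have kt : (k ^ 7 <= t)%N by near: t; exact: nbhs_infty_ge.
have t0 : (0 < t)%N by apply: leq_trans kt; rewrite expn_gt0.
have ku : (k <= root7 t)%N := leq_root7 kt.
have zt : ((t %/ root7 t) * k <= t)%N.
  by apply: leq_trans (leq_trunc_div t (root7 t)); rewrite leq_mul2l ku orbT.
have cke : c%:R <= e * k%:R.
  rewrite mulrC -ler_pdivrMr //; apply: ltW; apply: lt_le_trans (archi_boundP _) _.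
    by rewrite divr_ge0 // ltW.
  by rewrite ler_nat.
rewrite sub0r normrN ger0_norm ?divr_ge0 // ler_pdivrMr ?ltr0n //.
rewrite natrM; apply: (@le_trans _ _ (e * k%:R * (t %/ root7 t)%:R)).
  by rewrite ler_wpM2r.
rewrite -mulrA ler_wpM2l ?(ltW e0) // -natrM ler_nat mulnC //.
Unshelve. all: by end_near.
Qed.

Theorem theorem1p1 (R : realType) :
  exists g : nat -> R,
    [/\ forall t : nat, (0 < t)%N -> 0 <= g t,
        (fun t : nat => g t / t%:R) @ \oo --> (0 : R),
        forall (t n : nat), (0 < t)%N -> (0 < n)%N ->
          forall G : sgraph, #|G| = n -> ~ minor (complete t) G ->
            (num_cliques G)%:R <= 3 `^ (2 * t%:R / 3 + g t) * n%:R
      & \forall t \near \oo,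
          forall n : nat, 4 * t%:R / 3 <= n%:R :> R ->
            exists G : sgraph,
              [/\ #|G| = n, ~ minor (complete t) G
                & 3 `^ (2 * t%:R / 3 - g t) * n%:R <= (num_cliques G)%:R]].
Proof.
pose r : R := 3 `^ 3^-1.
have r_gt0 : 0 < r by apply: powR_gt0.
have r3 : r ^+ 3 = 3 by rewrite -(@powR_third _ 3 1) ?mul1r // powRr1.
exists (fun t => (4500 * (t %/ root7 t))%:R); split=> [t _||t n t0 n0 G Gn noK|].
- exact: ler0n.
- exact: quotient_root7_cvg0.
- rewrite (@powR_third _ (2 * t + 3 * (4500 * (t %/ root7 t)))) -/r; last first.
    by rewrite natrD !natrM; lra.
  by rewrite -Gn; apply: num_cliques_le; rewrite // Gn.
near=> t; have t1 : (1 < t)%N by near: t; exact: nbhs_infty_ge.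
move=> n tn; have tn' : (4 * t <= 3 * n)%N.
  by rewrite -(ler_nat R) !natrM; lra.
have [G [Gn noK bound]] := cocktail_bound r_gt0 r3 t1 tn'.
move: bound; set e := (4500 * _)%N => bound.
exists G; split=> //; rewrite powRD ?pnatr_eq0 ?implybT // powRN.
rewrite (@powR_third _ (3 * e) e%:R); last by rewrite [RHS]natrM mulrC.
rewrite (@powR_third _ (2 * t)) -/r; last by rewrite natrM divfK ?pnatr_eq0.
by rewrite mulrAC ler_pdivrMr ?exprn_gt0 // [leRHS]mulrC.
Unshelve. all: by end_near.
Qed.
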